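(* Let $E\subset\mathbb{Z}^d$ be bounded. Let $u$ be a function on $\tilde E$. If $L_a u(x)\ge -g(x)$ for all $x\in E$ such that $I_u(x)=I_u(x,E,a)\ne\emptyset$, then $$\max_E u\le \frac{d\,\operatorname{diam}\tilde E}{\varepsilon_0}\Bigg(\sum_{x\in E,\ I_u(x)\neq\emptyset}\big|g(x)(2d)^{l_x}\big|^d\Bigg)^{1/d}+\max_{E^b}u .$$ Here $a$, $L_a$, $l_x$, $E^b$, $\tilde E$, $I_u$ and $\varepsilon_0$ are as defined in the context, relative to a fixed environment $\omega$.
   Context: Let $d\ge2$, let $o$ be the origin and $|\cdot|$ the Euclidean norm. An environment $\omega$ assigns to each $x\in\mathbb{Z}^d$ a probability measure $\omega(x,\cdot)$ on $\{o,\pm e_1,\dots,\pm e_d\}$. The random environment is i.i.d. across sites, balanced ($\omega(x,e_i)=\omega(x,-e_i)$ for all $i$ and $x$, almost surely) and elliptic ($\omega(x,e)>0$ for all $|e|=1$ and all $x$, almost surely), and it is assumed that $\omega(x,o)=0$ for all $x$, almost surely. Fix such an environment $\omega$. Let $P_\omega^x$ be the law of the Markov chain $\{X_n\}$ with $X_0=x$ and transition probabilities $P_\omega^x\{X_{n+1}=y+v\mid X_n=y\}=\omega(y,v)$. Percolation. Let $\varepsilon_0>0$ be a constant. A site $x$ is open if $\min_i\omega(x,e_i)<\varepsilon_0$ and closed if $\min_i\omega(x,e_i)\ge\varepsilon_0$. An edge of $\mathbb{Z}^d$ is open if both its endpoints are open, and closed otherwise. Let $A$ be the subgraph of $\mathbb{Z}^d$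 obtained by deleting all closed edges and closed sites. A percolation cluster is a connected component of $A$ (also identified with its set of vertices). For a bounded set $B\subset\mathbb{Z}^d$ let $\partial B=\{y\in B^c:\ \exists x\in B,\ |x-y|_\infty=1\}$ and $\bar B=B\cup\partial B$. Write $d(x,y)=|x-y|_1=\sum_{i=1}^d|x_i-y_i|$. The $l^1$-diameter of a cluster $B$ is $l(B)=\sup_{x\in B,\,y\in\partial B}d(x,y)$. For $x\in A$, $A_x$ is the percolation cluster containing $x$ and $l_x$ is its $l^1$-diameter; for $x\notin A$, $A_x=\emptyset$ and $l_x=0$. The constant $\varepsilon_0$ is taken small enough that $l_x<\infty$ for all $x\in\mathbb{Z}^d$. Paths. Let $\square=\{(\kappa_1,\dots,\kappa_d)\in\mathbb{Z}^d:\kappa_i=\pm1\}$. A path from $x$ to $y$ is a sequence of sites $(x^1,\dots,x^n)$ with $x^1=x$, $x^n=y$ and $|x^j-x^{j+1}|=1$ for $j=1,\dots,n-1$. For $\kappa\in\square$ it is a $\kappa$-path if $\omega(x^j,x^{j+1}-x^j)\ge\frac1{2d}$ and $\kappa_i(x^{j+1}-x^j)_i\ge0$ for all $i=1,\dots,d$ and $j=1,\dots,n-1$. For each $\kappa\in\square$ pick a site $y_\kappa=y(x,\kappa)\in\partial A_x$ such that $$d(x,y_\kappa)=\max\{d(x,y):\ \text{there exists a }\kappa\text{-path in }\bar A_x\text{ from }x\text{ to }y\},$$ and let $\Lambda_x\subset\bar A_x$ be the union of (the points of) the $\kappa$-paths from $x$ to $y_\kappa$ over all $\kappa\in\square$.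 Operator. Let $\tau_{\Lambda_x}=\inf\{n>0:X_n\notin\Lambda_x\}$, $a(x,y)=P_\omega^x\{X_{\tau_{\Lambda_x}}=y\}$ and $L_af(x)=\sum_y a(x,y)(f(y)-f(x))$. For finite $E\subset\mathbb{Z}^d$ let $E^b=\{y\notin E: a(x,y)>0\text{ for some }x\in E\}$, $\tilde E=E\cup E^b$, $\operatorname{diam}\tilde E=\max\{|x-y|_\infty:x,y\in\tilde E\}$, and, for $x\in E$, $I_u(x)=I_u(x,E,a)=\{s\in\mathbb{R}^d: u(x)-s\cdot x\ge u(z)-s\cdot z\text{ for all }z\in\tilde E\}$. *)

(* Defs.v *)
(* MathComp / MathComp-Analysis *)
From HB Require Import structures.
From mathcomp Require Export all_boot all_order all_algebra.
From mathcomp Require Export all_classical all_reals all_analysis.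

Set Implicit Arguments.
Unset Strict Implicit.
Unset Printing Implicit Defensive.

Import Order.TTheory GRing.Theory Num.Theory.
Local Open Scope classical_set_scope.
Local Open Scope ring_scope.

Notation site d := 'rV[int]_d.

Definition e_ {d : nat} (i : 'I_d) : site d := delta_mx 0 i.

Definition enorm (R : realType) (d : nat) (v : site d) : R :=
  Num.sqrt (\sum_(i < d) (v 0 i)%:~R ^+ 2).

Definition norm1 (d : nat) (v : site d) : nat := (\sum_(i < d) `|v 0%R i|)%N.

Definition normoo (d : nat) (v : site d) : nat := (\max_(i < d) `|v 0%R i|)%N.

Definition dot (R : realType) (d : nat) (s : 'rV[R]_d) (x : site d) : R :=
  \sum_(i < d) s 0 i * (x 0 i)%:~R.

Definition bounded_sites (d : nat) (B : set (site d)) : Prop :=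
  exists N : nat, forall x, B x -> (normoo x <= N)%N.

(* [om x v] is the probability $\omega(x,v)$ of the jump from x to x + v. *)
Definition environment (R : realType) (d : nat) (om : site d -> site d -> R)
    : Prop :=
  [/\ forall x v, 0 <= om x v,
      forall x v, v <> 0 -> (forall i, v <> e_ i /\ v <> - e_ i) -> om x v = 0
    & forall x, om x 0 + \sum_(i < d) (om x (e_ i) + om x (- e_ i)) = 1].

Definition balanced (R : realType) (d : nat) (om : site d -> site d -> R)
    : Prop :=
  forall x i, om x (e_ i) = om x (- e_ i).

Definition elliptic (R : realType) (d : nat) (om : site d -> site d -> R)
    : Prop :=
  forall x e, enorm R e = 1 -> 0 < om x e.

(* X is a Markov chain started at x with transitions om under P; as the state
   space is countable, measurability of X n is measurability of its fibres. *)
Definition markov_chain (R : realType) (d : nat) (om : site d -> site d -> R)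
    (disp : measure_display) (Omega : measurableType disp)
    (P : probability Omega R) (X : nat -> Omega -> site d) (x : site d)
    : Prop :=
  [/\ forall n z, measurable [set w | X n w = z],
      P [set w | X 0%N w = x] = 1%E
    & forall n (h : nat -> site d) (v : site d),
        P [set w | (forall k, (k <= n)%N -> X k w = h k)
                   /\ X n.+1 w = h n + v]
        = (P [set w | forall k, (k <= n)%N -> X k w = h k]
           * (om (h n) v)%:E)%E].

Section Percolation.
Context {R : realType} {d : nat}.
Variables (om : site d -> site d -> R) (eps0 : R).

(* The default value 1 is neutral: a probability never exceeds it. *)
Definition open_site (x : site d) : bool :=
  \big[Num.min/1]_(i < d) om x (e_ i) < eps0.

Definition open_edge (x y : site d) : bool :=
  [&& enorm R (y - x) == 1, open_site x & open_site y].

(* $A_x$, empty when x is closed *)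
Definition cluster (x : site d) : set (site d) :=
  [set y | open_site x /\
           exists p : seq (site d), path open_edge x p /\ last x p = y].

Definition boundary (B : set (site d)) : set (site d) :=
  [set y | ~ B y /\ exists2 x, B x & normoo (x - y) = 1%N].

Definition bar (B : set (site d)) : set (site d) := B `|` boundary B.

(* The boundary is meaningful for bounded sets only (the whole lattice has none,
   which would make the supremum -oo), so unbounded clusters get +oo. *)
Definition l1_diam (B : set (site d)) : \bar R :=
  if `[< bounded_sites B >] then
    ereal_sup [set (norm1 (x - y))%:R%:E | x in B & y in boundary B]
  else +oo%E.

Definition ell (x : site d) : \bar R :=
  if open_site x then l1_diam (cluster x) else 0%E.

Definition square : set (site d) :=
  [set k | forall i, k 0 i = 1 \/ k 0 i = -1].

Definition kstep (k x y : site d) : bool :=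
  [&& enorm R (y - x) == 1, om x (y - x) >= (2 * d)%:R^-1
    & [forall i : 'I_d, 0 <= k 0 i * (y - x) 0 i]].

(* x :: p is a k-path from x to y that stays in $\bar A_x$ *)
Definition kpath (k x y : site d) (p : seq (site d)) : Prop :=
  [/\ path (kstep k) x p, last x p = y
    & forall z, z \in x :: p -> bar (cluster x) z].

(* [Y x k] is the selected site $y(x,\kappa)$, an arbitrary maximiser; nothing
   is required at closed x, where $A_x$ and its boundary are empty. *)
Definition selection (Y : site d -> site d -> site d) : Prop :=
  forall x k, open_site x -> square k ->
    [/\ boundary (cluster x) (Y x k),
        exists p, kpath k x (Y x k) p
      & forall y p, kpath k x y p -> (norm1 (x - y) <= norm1 (x - Y x k))%N].

(* Empty when x is closed, so that the exit time below is then 1. *)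
Definition Lambda (Y : site d -> site d -> site d) (x : site d)
    : set (site d) :=
  [set z | exists k p, [/\ square k, kpath k x (Y x k) p & z \in x :: p]].

End Percolation.

Definition exit_time (R : realType) (d : nat) (Omega : Type)
    (X : nat -> Omega -> site d) (L : set (site d)) (w : Omega) : \bar R :=
  ereal_inf [set n%:R%:E | n in [set n : nat | (0 < n)%N /\ ~ L (X n w)]].

Definition exit_prob (R : realType) (d : nat) (disp : measure_display)
    (Omega : measurableType disp) (P : site d -> probability Omega R)
    (X : nat -> Omega -> site d) (L : site d -> set (site d))
    (x y : site d) : R :=
  fine (P x [set w | exists n : nat,
                exit_time R X (L x) w = n%:R%:E /\ X n w = y]).

Section Operator.
Context {R : realType} {d : nat}.
Variable a : site d -> site d -> R.

(* [\sum_(y \in setT)] is the sum over the support of the summand, which is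
   finite whenever a x has finite support. *)
Definition Lop (f : site d -> R) (x : site d) : R :=
  \sum_(y \in [set: site d]) a x y * (f y - f x).

Definition Eb (E : set (site d)) : set (site d) :=
  [set y | ~ E y /\ exists2 x, E x & 0 < a x y].

Definition Etilde (E : set (site d)) : set (site d) := E `|` Eb E.

Definition diam (E : set (site d)) : R :=
  sup [set (normoo (x - y))%:R | x in Etilde E & y in Etilde E].

Definition Iu (u : site d -> R) (E : set (site d)) (x : site d)
    : set 'rV[R]_d :=
  [set s | forall z, Etilde E z -> u x - dot s x >= u z - dot s z].

End Operator.

(* Main.v *)
From mathcomp Require Import ring lra zify.
Require Import Defs.

Set Implicit Arguments.
Unset Strict Implicit.
Unset Printing Implicit Defensive.

Import Order.TTheory GRing.Theory Num.Theory.
Import numFieldNormedType.Exports.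
Local Open Scope classical_set_scope.
Local Open Scope ring_scope.

(** The proof follows the Alexandrov-Bakelman-Pucci scheme: slopes of supporting
    hyperplanes of [u] fill a cube of side proportional to
    [max_E u - max_(E^b) u], whereas each single site contributes a set of
    slopes that [g] forces to be small.

    Slopes fill a cube.  Let [x0] maximise [u] on [E].  If every coordinate of
    [s] is at most [m = (max_E u - max_(E^b) u) / (d diam)] in absolute value,
    then tilting [u] by [s] changes differences of values by at most
    [d m diam], so the maximum of [u - s] over the closure of [E] is still
    attained in [E], at a site [x] with [s] in [I_u(x)] ([slopes_cover]).

    Each site contributes little.  Let [p] and [q] be in [I_u(x)] and
    [w = u - p].  The kernel [a] has mean zero, hence
    [sum_v a(x,v) (w(x) - w(v)) <= g(x)]; all terms being nonnegative, each of
    them is at most [g(x)] ([drop_le]).  If [v] lies in the orthant opposite to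
    the signs of [q - p], at distance at least 1 from [x] in direction [j],
    then [q_j - p_j <= w(x) - w(v)].  So [I_u(x)] has all its coordinate widths
    bounded by [g(x) W(x)] as soon as such a [v] exists, for each orthant and
    each direction, with [a(x,v) W(x) >= 1] ([slope_gap]).  Comparing volumes
    ([cube_cover]) gives the estimate ([maximum_principle]).

    It remains to see that the exit kernel of the walk has these properties.
    Mean zero is optional stopping for the walk killed outside a finite set:
    the martingale [|X_n|^2 - n] bounds the mean exit time, so the surviving
    mass vanishes ([exit_mean]).  For the lower bound with
    [W(x) = (2d)^(l_x) / eps0] ([exit_orthant]), one follows an orthant path
    from [x] to a closed site [z], where every direction has probability at
    least [eps0].  The selected site [y_kappa] need not be closed, as it may
    belong to another cluster, but the path to it leaves the cluster of [x]
    through a closed site.  From [z] one steps in direction [j].  If this leaves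
    [Lambda_x], the path has length at most [l_x + 1] and weight at least
    [(2d)^(-l_x) eps0].  Otherwise the new site is itself the end of an orthant
    path inside [Lambda_x], which is extended by steps of probability at least
    [1/(2d)] until it leaves; maximality of [y_kappa] limits its length to
    [l_x + 1], and [1/(2d) >= eps0] because a closed site exists. *)

(** * Nearest neighbour jumps *)

Lemma coord_e (d : nat) (i j : 'I_d) : (e_ i : site d) 0 j = (j == i)%:R.
Proof. by rewrite mxE eqxx. Qed.

Lemma e_inj (d : nat) (i j : 'I_d) : (e_ i == e_ j) = (i == j).
Proof.
apply/eqP/eqP => [/(congr1 (fun v : site d => v 0 i))|-> //].
by rewrite !coord_e eqxx; case: eqP.
Qed.

Lemma eN_neq (d : nat) (i j : 'I_d) : (- e_ i == e_ j) = false.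
Proof.
apply/eqP => /(congr1 (fun v : site d => v 0 i)).
by rewrite !mxE !eqxx /=; case: eqP.
Qed.

(** The average of [f] over one jump of a walk that never stays put. *)
Definition mean (R : realType) (d : nat) (om : site d -> site d -> R)
    (f : site d -> R) (y : site d) : R :=
  \sum_(i < d) (om y (e_ i) * f (y + e_ i) + om y (- e_ i) * f (y - e_ i)).

(** Writing the jump law as a combination of indicators of the unit vectors turns
    sums over sites into sums over the [2 d] directions. *)
Lemma om_jumps (R : realType) (d : nat) (om : site d -> site d -> R) y v :
  environment om -> (forall x, om x 0 = 0) ->
  om y v = \sum_(i < d) (om y (e_ i) * (v == e_ i)%:R
                         + om y (- e_ i) * (v == - e_ i)%:R).
Proof.
move=> [om0 supp tot] lazy.
have [[i vi]|noi] := pselect (exists i, v = e_ i \/ v = - e_ i).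
  rewrite (bigD1 i) //= big1 ?addr0 => [|j ji].
    case: vi => ->; first by rewrite eqxx eq_sym eN_neq mulr1 mulr0 addr0.
    by rewrite eqxx eN_neq mulr1 mulr0 add0r.
  case: vi => ->; rewrite ?eqr_opp e_inj [i == j]eq_sym (negPf ji).
    by rewrite eq_sym eN_neq !mulr0 addr0.
  by rewrite eN_neq !mulr0 addr0.
rewrite big1 => [|i _].
  have [->|/eqP v0] := eqVneq v 0; first exact: lazy.
  by apply: supp => // i; split=> vi; apply: noi; exists i; [left|right].
have [vi|_] := eqVneq v (e_ i); first by case: noi; exists i; left.
have [vi|_] := eqVneq v (- e_ i); first by case: noi; exists i; right.
by rewrite !mulr0 addr0.
Qed.

Lemma big_seq_eq (R : realType) (T : eqType) (r : seq T) (f : T -> R) y :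
  uniq r -> y \in r -> \sum_(z <- r) (z == y)%:R * f z = f y.
Proof.
move=> ur yr; rewrite (bigD1_seq y) //= eqxx mul1r big1 ?addr0 // => z zy.
by rewrite (negPf zy) mul0r.
Qed.

Lemma sum_jumps (R : realType) (d : nat) (om : site d -> site d -> R)
    (r : seq (site d)) (f : site d -> R) y :
  environment om -> (forall x, om x 0 = 0) -> uniq r ->
  (forall i, y + e_ i \in r /\ y - e_ i \in r) ->
  \sum_(z <- r) om y (z - y) * f z = mean om f y.
Proof.
move=> env lazy ur yr.
under eq_bigr do rewrite (om_jumps _ _ env lazy) mulr_suml.
rewrite exchange_big; apply: eq_bigr => i _ /=.
have [yir yir'] := yr i.
under eq_bigr do rewrite mulrDl -!mulrA !subr_eq [e_ i + y]addrC [- e_ i + y]addrC.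
by rewrite big_split /= -!mulr_sumr !big_seq_eq.
Qed.

Lemma sum_om (R : realType) (d : nat) (om : site d -> site d -> R) y :
  environment om -> balanced om -> (forall x, om x 0 = 0) ->
  \sum_(i < d) om y (e_ i) * 2 = 1.
Proof.
move=> [_ _ tot] bal lazy; rewrite -[RHS](tot y) lazy add0r.
by apply: eq_bigr => i _; rewrite -bal -mulr2n mulr_natr.
Qed.

Lemma mean_dot (R : realType) (d : nat) (om : site d -> site d -> R)
    (s : 'rV[R]_d) (c : R) y :
  environment om -> balanced om -> (forall x, om x 0 = 0) ->
  mean om (fun z => dot s z + c) y = dot s y + c.
Proof.
move=> env bal lazy.
rewrite -[RHS]mul1r -[X in X * _](sum_om y env bal lazy) mulr_suml.
apply: eq_bigr => i _; rewrite -bal.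
have dotD (u v : site d) : dot s (u + v) = dot s u + dot s v.
  rewrite /dot -big_split /=; apply: eq_bigr => j _.
  by rewrite mxE intrD mulrDr.
have dotN (u : site d) : dot s (- u) = - dot s u.
  rewrite /dot -sumrN; apply: eq_bigr => j _.
  by rewrite mxE rmorphN mulrN.
by rewrite !dotD dotN; ring.
Qed.

Definition sqnorm (R : realType) (d : nat) (z : site d) : R :=
  \sum_(i < d) (z 0 i)%:~R ^+ 2.

(** [|X_n|^2 - n] is a martingale, as all jumps have length 1 and mean zero.
    The constant [c] serves to make the function nonnegative on a finite set. *)
Lemma mean_sqnorm (R : realType) (d : nat) (om : site d -> site d -> R)
    (c : R) y :
  environment om -> balanced om -> (forall x, om x 0 = 0) ->
  mean om (fun z => c - sqnorm R z) y = c - sqnorm R y - 1.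
Proof.
move=> env bal lazy.
have sq (i : 'I_d) : sqnorm R (y + e_ i) + sqnorm R (y - e_ i)
    = 2 * (sqnorm R y + 1).
  transitivity (2 * (sqnorm R y + \sum_(j < d) (j == i)%:R)); last first.
    by rewrite (bigD1 i) //= eqxx big1 ?addr0 // => j /negPf ->.
  rewrite /sqnorm -!big_split /= mulr_sumr; apply: eq_bigr => j _.
  rewrite !mxE eqxx /= rmorphB /= rmorphD /=.
  by case: eqP => _ /=; ring.
rewrite -[RHS]mul1r -[X in X * _](sum_om y env bal lazy) mulr_suml.
apply: eq_bigr => i _.
rewrite -bal -mulrDr addrACA -opprD sq -mulrA; congr (_ * _). ring.
Qed.

(** * The Markov property for events of the past *)

Section History.
Context {R : realType} {d : nat}.
Context (om : site d -> site d -> R).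
Context {disp : measure_display} {Omega : measurableType disp}.
Context (P : probability Omega R) (X : nat -> Omega -> site d) (x : site d).
Context (chain : markov_chain om P X x).

(** The events determined by the trajectory up to time [n]. *)
Definition history (n : nat) (B : set Omega) : Prop :=
  forall w w', (forall k, (k <= n)%N -> X k w = X k w') -> B w -> B w'.

(** Trajectories up to time [n] form a countable set: [code] numbers them, so
    that an event of the past is a countable union of cylinders. *)
Definition code (n : nat) (w : Omega) : nat :=
  pickle [seq X k w | k <- iota 0 n.+1].

Lemma code_eq n w w' :
  code n w = code n w' <-> forall k, (k <= n)%N -> X k w = X k w'.
Proof.
rewrite /code; split.
  move=> /(pcan_inj pickleK) e k kn.
  by move/eq_in_map: e; apply; rewrite mem_iota.
move=> e; congr pickle; apply/eq_in_map => k.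
by rewrite mem_iota => /andP[_ kn]; apply: e.
Qed.

Lemma measurable_cylinder n (h : nat -> site d) :
  measurable [set w | forall k, (k <= n)%N -> X k w = h k].
Proof.
have [mX _ _] := chain.
have -> : [set w | forall k, (k <= n)%N -> X k w = h k] =
    \bigcap_(k in `I_n.+1) [set w | X k w = h k].
  by apply/seteqP; split => w /= H k; apply: H.
by apply: bigcap_measurable => [|k _]; [exists 0%N|exact: mX].
Qed.

Lemma history_code n (B : set Omega) w : history n B -> B w ->
  B `&` [set v | code n v = code n w] =
  [set v | forall k, (k <= n)%N -> X k v = X k w].
Proof.
move=> hB Bw; apply/seteqP; split => v /=; first by case=> _ /code_eq.
by move=> vw; split; [apply: hB Bw => k kn; rewrite vw|apply/code_eq].
Qed.

Lemma measurable_code n (B : set Omega) i : history n B ->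
  measurable (B `&` [set w | code n w = i]).
Proof.
move=> hB; have [[w [Bw <-]]|noB] := pselect (exists w, B w /\ code n w = i).
  by rewrite (history_code hB Bw); exact: measurable_cylinder.
suff -> : B `&` [set w | code n w = i] = set0 by exact: measurable0.
by apply/seteqP; split => // w [Bw wi]; case: noB; exists w.
Qed.

Lemma bigcup_code n (B : set Omega) :
  B = \bigcup_(i in setT) (B `&` [set w | code n w = i]).
Proof. by apply/seteqP; split => [w Bw|w [i _ []] //]; exists (code n w). Qed.

Lemma measurable_history n (B : set Omega) : history n B -> measurable B.
Proof.
by move=> hB; rewrite (bigcup_code n B); apply: bigcup_measurable => i _;
  exact: measurable_code.
Qed.

(** The Markov property is given on single trajectories only; countable
    additivity extends it to every event of the past that fixes the present. *)
Lemma markov_history n (B : set Omega) (y v : site d) : history n B ->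
  (forall w, B w -> X n w = y) ->
  P (B `&` [set w | X n.+1 w = y + v]) = (P B * (om y v)%:E)%E.
Proof.
move=> hB By; have [mX _ step] := chain.
rewrite [X in P (X `&` _)](bigcup_code n B) setI_bigcupl.
rewrite [X in _ = (P X * _)%E](bigcup_code n B).
rewrite !measure_bigcup //; last 4 first.
- by move=> i _; exact: measurable_code.
- exact: trivIset_preimage1_in.
- by move=> i _; apply: measurableI; [exact: measurable_code|exact: mX].
- exact/trivIset_setIr/trivIset_preimage1_in.
rewrite muleC -nneseriesZl //; apply: eq_eseriesr => i _; rewrite muleC.
have [[w [Bw <-]]|noB] := pselect (exists w, B w /\ code n w = i).
  rewrite (history_code hB Bw) -(By w Bw) -(step n (X^~ w)).
  by congr (P _); apply/seteqP; split.
suff -> : B `&` [set w | code n w = i] = set0 by rewrite set0I !measure0 mul0e.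
by apply/seteqP; split => // w [Bw wi]; case: noB; exists w.
Qed.

End History.

(** * The walk killed on leaving a finite set *)

Section Killed.
Context {R : realType} {d : nat}.
Context (om : site d -> site d -> R).
Context {disp : measure_display} {Omega : measurableType disp}.
Context (P : probability Omega R) (X : nat -> Omega -> site d) (x : site d).
Context (chain : markov_chain om P X x) (L : set (site d)).

(** For [n = 0] the starting site may lie outside [L]: the exit time is positive. *)
Definition survive (n : nat) : set Omega :=
  [set w | X 0%N w = x /\ forall k, (0 < k <= n)%N -> L (X k w)].

Definition alive (n : nat) (z : site d) : R :=
  fine (P (survive n `&` [set w | X n w = z])).

(** The mass that survives up to time [n] and then jumps to [z]; it is still alive
    when [z] is in [L], and otherwise it exits at time [n.+1]. *)
Definition arrive (n : nat) (z : site d) : R :=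
  fine (P (survive n `&` [set w | X n.+1 w = z])).

Lemma fine_prob (A : set Omega) : measurable A -> (fine (P A))%:E = P A.
Proof. by move=> mA; rewrite fineK // fin_num_measure. Qed.

Lemma history_alive n z : history X n (survive n `&` [set w | X n w = z]).
Proof.
move=> w w' ww' [[w0 wL] wz]; split; last by rewrite /= -ww'.
split; first by rewrite -ww'.
by move=> k /andP[k0 kn]; rewrite -ww' //; apply: wL; rewrite k0.
Qed.

Lemma history_arrive n z : history X n.+1 (survive n `&` [set w | X n.+1 w = z]).
Proof.
move=> w w' ww' [[w0 wL] wz]; split; last by rewrite /= -ww'.
split; first by rewrite -ww'.
by move=> k /andP[k0 kn]; rewrite -ww' ?leqW //; apply: wL; rewrite k0.
Qed.

Lemma alive_ge0 n z : 0 <= alive n z.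
Proof. by rewrite fine_ge0. Qed.

Lemma arrive_ge0 n z : 0 <= arrive n z.
Proof. by rewrite fine_ge0. Qed.

Lemma P_start (A : set Omega) : measurable A ->
  P (A `&` [set w | X 0%N w = x]) = P A.
Proof.
move=> mA; have [mX P0 _] := chain.
apply/eqP; rewrite eq_le; apply/andP; split.
  by apply: le_measure; rewrite ?inE //; apply: measurableI.
have mN : measurable (~` [set w | X 0%N w = x]) by apply: measurableC.
have PN : P (~` [set w | X 0%N w = x]) = 0%E.
  by rewrite probability_setC // P0 subee.
rewrite -[X in (_ <= X)%E]adde0 -PN.
rewrite -[X in (P X <= _)%E]setIT -(setUv [set w | X 0%N w = x]) setIUr.
apply: le_trans (measureU2 _ _ _) _; [exact: measurableI|exact: measurableI|].
apply: leeD => //; apply: le_measure; rewrite ?inE //; exact: measurableI.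
Qed.

Lemma alive0 z : alive 0 z = (z == x)%:R.
Proof.
have [mX P0 _] := chain; rewrite /alive; have [->|/eqP zx] := eqVneq z x.
  suff -> : survive 0 `&` [set w | X 0%N w = x] = [set w | X 0%N w = x].
    by rewrite P0.
  by apply/seteqP; split => [w []//|w wx]; split => //; split => // -[].
suff -> : survive 0 `&` [set w | X 0%N w = z] = set0 by rewrite measure0.
by apply/seteqP; split => // w [[wx _] /= wz]; apply: zx; rewrite -wz.
Qed.

Lemma alive_succ n z : L z -> alive n.+1 z = arrive n z.
Proof.
move=> Lz; rewrite /alive /arrive; congr (fine (P _)).
apply/seteqP; split => w [[w0 wL] /= wz]; split => //; split => // k.
  by move=> /andP[k0 kn]; apply: wL; rewrite k0 leqW.
move=> /andP[k0]; rewrite leq_eqVlt ltnS => /orP[/eqP ->|kn]; first by rewrite wz.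
by apply: wL; rewrite k0.
Qed.

Lemma alive_out n z : z <> x -> ~ L z -> alive n z = 0.
Proof.
move=> zx nLz; rewrite /alive.
suff -> : survive n `&` [set w | X n w = z] = set0 by rewrite measure0.
apply/seteqP; split => // w [[w0 wL] /= wz].
case: n wL wz => [_ wz|n wL wz]; first by apply: zx; rewrite -wz.
by apply: nLz; rewrite -wz; apply: wL; rewrite ltn0Sn leqnn.
Qed.

Lemma alive_succ_out n z : ~ L z -> alive n.+1 z = 0.
Proof.
move=> nLz; rewrite /alive.
suff -> : survive n.+1 `&` [set w | X n.+1 w = z] = set0 by rewrite measure0.
apply/seteqP; split => // w [[w0 wL] /= wz].
by apply: nLz; rewrite -wz; apply: wL; rewrite ltn0Sn leqnn.
Qed.

(** The Chapman-Kolmogorov equation of the killed walk. *)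
Lemma arrive_sum (r : seq (site d)) n z : uniq r ->
  (forall y, y = x \/ L y -> y \in r) ->
  arrive n z = \sum_(y <- r) alive n y * om y (z - y).
Proof.
move=> ur xLr; have [mX _ _] := chain.
apply: EFin_inj; rewrite /arrive fine_prob;
  last exact/(measurable_history chain)/history_arrive.
have hA y := @history_alive n y.
have -> : survive n `&` [set w | X n.+1 w = z] =
    \bigcup_(y in [set` r]) ((survive n `&` [set w | X n w = y])
                              `&` [set w | X n.+1 w = y + (z - y)]).
  apply/seteqP; split => w.
    move=> [[w0 wL] /= wz]; exists (X n w); last first.
      by split=> //=; rewrite addrC subrK.
    apply: xLr; case: n wL {wz hA} => [_|n wL]; first by left.
    by right; apply: wL; rewrite ltn0Sn leqnn.
  by move=> [y _ [[wS _] /= ->]]; split=> //=; rewrite addrC subrK.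
have mA y : measurable (survive n `&` [set w | X n w = y]).
  exact/(measurable_history chain)/hA.
rewrite measure_fin_bigcup //; last 3 first.
- exact: finite_seq.
- by move=> y y' _ _ [w [[[_ /= <-] _] [[_ /= <-] _]]].
- by move=> y _; apply: measurableI.
rewrite -fsbig_seq // -sumEFin; apply: eq_bigr => y _.
rewrite EFinM /alive fine_prob //.
by apply: (markov_history chain (z - y) (hA y)) => w [].
Qed.

Context (env : environment om) (lazy : forall y, om y 0 = 0).
Context (r : seq (site d)) (ur : uniq r).
Context (rL : forall y, y = x \/ L y ->
  y \in r /\ forall i, y + e_ i \in r /\ y - e_ i \in r).

(** One step of the killed walk: what is tested against [f] at time [n.+1],
    counting the mass that exits then, is what was tested against the mean of
    [f] at time [n]. *)
Lemma conservation n (f : site d -> R) :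
  \sum_(y <- r) alive n.+1 y * f y + \sum_(z <- r | `[< ~ L z >]) arrive n z * f z
  = \sum_(y <- r) alive n y * mean om f y.
Proof.
have rL1 y : y = x \/ L y -> y \in r by move=> /rL[].
rewrite (bigID (fun z => `[< ~ L z >])) /= big1 ?add0r; last first.
  by move=> y /asboolP nL; rewrite alive_succ_out ?mul0r.
transitivity (\sum_(z <- r) arrive n z * f z).
  rewrite [RHS](bigID (fun z => `[< ~ L z >])) /= addrC; congr (_ + _).
  by apply: eq_bigr => y /asboolPn /contrapT Ly; rewrite alive_succ.
under [LHS]eq_bigr do rewrite (arrive_sum n _ ur rL1) mulr_suml.
rewrite exchange_big /=; apply: eq_bigr => y _.
under eq_bigr do rewrite -mulrA.
rewrite -mulr_sumr; have [yL|nyL] := pselect (y = x \/ L y).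
  by rewrite sum_jumps //; exact: (rL yL).2.
by rewrite alive_out ?mul0r // => yL; apply: nyL; [left|right].
Qed.

(** Optional stopping at the minimum of [N] and the exit time. *)
Lemma stopped_mean N (f : site d -> R) : (forall y, mean om f y = f y) ->
  \sum_(y <- r) alive N y * f y
  + \sum_(z <- r | `[< ~ L z >]) (\sum_(n < N) arrive n z) * f z = f x.
Proof.
move=> harm; have xr : x \in r by case: (@rL x (or_introl erefl)).
elim: N => [|N IH].
  under eq_bigr do rewrite alive0.
  rewrite big_seq_eq // big1 ?addr0 // => z _.
  by rewrite big_ord0 mul0r.
rewrite -{}IH; under [X in _ + X]eq_bigr do rewrite big_ord_recr /= mulrDl.
rewrite big_split /= addrCA conservation addrC; congr (_ + _).
by apply: eq_bigr => y _; rewrite harm.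
Qed.

Context (bal : balanced om).

(** The expected exit time is finite: along the walk, [f = K - |z|^2] is
    nonnegative on [r] and loses in mean one unit of height per unit of time. *)
Lemma alive_summable : exists C : R, forall N,
  \sum_(n < N) \sum_(y <- r) alive n y <= C.
Proof.
have xr : x \in r by case: (@rL x (or_introl erefl)).
pose K : R := \sum_(z <- r) sqnorm R z.
have sq0 (z : site d) : 0 <= sqnorm R z by apply: sumr_ge0 => i _; exact: sqr_ge0.
pose f (z : site d) := K - sqnorm R z.
have f0 z : z \in r -> 0 <= f z.
  by move=> zr; rewrite /f subr_ge0 /K (big_rem _ zr) /= lerDl sumr_ge0.
have step n : \sum_(y <- r) alive n y + \sum_(y <- r) alive n.+1 y * f y
    <= \sum_(y <- r) alive n y * f y.
  have := conservation n f.
  under [X in _ = X -> _]eq_bigr do rewrite (mean_sqnorm _ _ env bal lazy) mulrBr mulr1.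
  rewrite sumrB => /eqP; rewrite -subr_eq opprK => /eqP <-.
  rewrite addrC lerD2r lerDl big_seq_cond; apply: sumr_ge0 => z /andP[zr _].
  by rewrite mulr_ge0 ?arrive_ge0 // f0.
exists (f x) => N.
have bound : \sum_(n < N) \sum_(y <- r) alive n y
    + \sum_(y <- r) alive N y * f y <= f x.
  elim: N => [|N IH].
    rewrite big_ord0 add0r; under eq_bigr do rewrite alive0.
    by rewrite big_seq_eq.
  by rewrite big_ord_recr /= -addrA (le_trans _ IH) // lerD2l.
apply: le_trans bound; rewrite lerDl big_seq; apply: sumr_ge0 => y yr.
by rewrite mulr_ge0 ?alive_ge0 // f0.
Qed.

Lemma alive_vanish z : (fun n => alive n z) @ \oo --> 0.
Proof.
have [C sumC] := alive_summable.
pose u n := \sum_(y <- r) alive n y.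
have u0 n : 0 <= u n by apply: sumr_ge0 => y _; exact: alive_ge0.
have cu : u @ \oo --> 0.
  apply: cvg_series_cvg_0; apply: nondecreasing_is_cvgn.
    by apply/nondecreasing_seqP => n; rewrite seriesSr lerDl.
  by exists C => _ [n _ <-]; rewrite seriesEord; exact: sumC.
apply: (squeeze_cvgr _ (cvg_cst 0) cu).
near=> n; rewrite alive_ge0 /= /u; have [zr|zr] := boolP (z \in r).
  rewrite (big_rem _ zr) /= lerDl.
  by apply: sumr_ge0 => y _; exact: alive_ge0.
rewrite alive_out; first exact: u0.
  by move=> zx; case/negP: zr; case: (@rL z (or_introl zx)).
by move=> Lz; case/negP: zr; case: (@rL z (or_intror Lz)).
Unshelve. all: by end_near. Qed.

Definition exit_at (z : site d) : set Omega :=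
  [set w | exists n : nat, exit_time R X L w = n%:R%:E /\ X n w = z].

Lemma exit_timeP w n : exit_time R X L w = n%:R%:E <->
  [/\ (0 < n)%N, ~ L (X n w) & forall k, (0 < k < n)%N -> L (X k w)].
Proof.
have lb m : (0 < m)%N -> ~ L (X m w) -> (forall k, (0 < k < m)%N -> L (X k w)) ->
    exit_time R X L w = m%:R%:E.
  move=> m0 mL kL; apply/eqP; rewrite eq_le; apply/andP; split.
    by apply: ereal_inf_lbound; exists m.
  apply: le_ereal_inf_tmp => _ [k [k0 nL] <-]; rewrite lee_fin ler_nat leqNgt.
  by apply/negP => km; apply: nL; apply: kL; rewrite k0.
split=> [tau|[n0 nL kL]]; last exact: lb.
have [out|stay] := pselect (exists k, (0 < k)%N && `[< ~ L (X k w) >]).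
  have [m /andP[m0 /asboolP mL] mmin] := ex_minnP out.
  have taum : exit_time R X L w = m%:R%:E.
    apply: lb => // k /andP[k0 km]; apply: contrapT => nL.
    by have := mmin k; rewrite k0 (asboolT nL) leqNgt km => /(_ isT).
  move: tau; rewrite taum => -[] /eqP; rewrite eqr_nat => /eqP <-; split=> //.
  move=> k /andP[k0 km]; apply: contrapT => nL.
  by have := mmin k; rewrite k0 (asboolT nL) leqNgt km => /(_ isT).
move: tau; rewrite /exit_time (_ : [set k : nat | (0 < k)%N /\ ~ L (X k w)] = set0).
  by rewrite image_set0 ereal_inf0.
apply/seteqP; split => // k [k0 kL]; apply: stay; exists k.
by rewrite k0 /=; apply/asboolP.
Qed.

Lemma exit_at_in z : L z -> exit_at z = set0.
Proof.
move=> Lz; apply/seteqP; split => // w [n [/exit_timeP[_ nL _] Xn]].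
by apply: nL; rewrite Xn.
Qed.

Lemma exit_at_out z : ~ L z -> exit_at z =
  \bigcup_n [set w | (forall k, (0 < k <= n)%N -> L (X k w)) /\ X n.+1 w = z].
Proof.
move=> nLz; apply/seteqP; split => w.
  move=> [[|n] [/exit_timeP[n0 nL kL] Xn]] //.
  by exists n => //; split=> // k /andP[k0 kn]; apply: kL; rewrite k0.
move=> [n _ [kL Xn]]; exists n.+1; split=> //; apply/exit_timeP; split=> //.
by rewrite Xn.
Qed.

Lemma measurable_exit_at z : measurable (exit_at z).
Proof.
have [Lz|nLz] := pselect (L z); first by rewrite exit_at_in.
rewrite exit_at_out //; apply: bigcupT_measurable => n.
apply: (measurable_history chain (n := n.+1)).
move=> w w' ww' [wL wz]; split; last by rewrite -ww'.
by move=> k /andP[k0 kn]; rewrite -ww' ?leqW //; apply: wL; rewrite k0.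
Qed.

(** The exit at [z] splits according to the exit time into disjoint events. *)
Lemma exit_cvg z : ~ L z ->
  (fun N => \sum_(n < N) arrive n z) @ \oo --> fine (P (exit_at z)).
Proof.
move=> nLz.
have -> : P (exit_at z) = P (\bigcup_n (survive n `&` [set w | X n.+1 w = z])).
  rewrite -P_start; last exact: measurable_exit_at.
  congr (P _); rewrite exit_at_out //; apply/seteqP; split => w.
    by move=> [[n _ [kL Xn]] X0]; exists n.
  by move=> [n _ [[X0 kL] Xn]]; split=> //; exists n.
have mF n : measurable (survive n `&` [set w | X n.+1 w = z]).
  exact/(measurable_history chain)/history_arrive.
have trivF : trivIset setT (fun n => survive n `&` [set w | X n.+1 w = z]).
  apply: ltn_trivIset => n m mn; apply/seteqP; split=> // w.
  move=> [[[_ kL] Xm] [[_ kL'] _]]; apply: nLz; rewrite -Xm; apply: kL'.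
  by rewrite ltn0Sn.
have mB := bigcupT_measurable _ mF.
have lim := @measure_semi_sigma_additive _ _ _ P _ mF trivF mB.
have {}lim : (fun N => (\sum_(n < N) arrive n z)%:E) @ \oo
    --> (fine (P (\bigcup_n (survive n `&` [set w | X n.+1 w = z]))))%:E.
  rewrite fine_prob //; apply: cvg_trans lim; apply: near_eq_cvg; near=> N.
  by rewrite big_mkord -sumEFin; apply: eq_bigr => n _; rewrite fine_prob.
exact: (fine_cvg lim).
Unshelve. all: by end_near. Qed.

Lemma exit_far z : z \notin r -> P (exit_at z) = 0%E.
Proof.
move=> zr; have [Lz|nLz] := pselect (L z); first by rewrite exit_at_in ?measure0.
have rL1 y : y = x \/ L y -> y \in r by move=> /rL[].
have arrive0 n : arrive n z = 0.
  rewrite (arrive_sum _ _ ur rL1) big1 // => y _.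
  have [yL|nyL] := pselect (y = x \/ L y); last first.
    by rewrite alive_out ?mul0r // => yL; apply: nyL; [left|right].
  rewrite (om_jumps _ _ env lazy) big1 ?mulr0 // => i _.
  have [yi yi'] := (rL yL).2 i.
  rewrite !subr_eq [e_ i + y]addrC [- e_ i + y]addrC.
  have -> : z == y + e_ i = false by apply/eqP => zE; rewrite zE yi in zr.
  have -> : z == y - e_ i = false by apply/eqP => zE; rewrite zE yi' in zr.
  by rewrite !mulr0 addr0.
rewrite -fine_prob; last exact: measurable_exit_at.
rewrite -(cvg_lim (@Rhausdorff R) (exit_cvg nLz)) (_ : (fun N => _) = cst 0).
  by rewrite lim_cst.
by apply/funext => N; rewrite big1 // => n _; exact: arrive0.
Qed.

(** Optional stopping at the exit time itself, as the surviving mass vanishes. *)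
Lemma exit_mean (f : site d -> R) : (forall y, mean om f y = f y) ->
  \sum_(z <- r) fine (P (exit_at z)) * f z = f x.
Proof.
move=> harm.
rewrite (bigID (fun z => `[< ~ L z >])) /= [X in _ + X]big1 ?addr0; last first.
  by move=> z /asboolPn/contrapT Lz; rewrite exit_at_in // measure0 mul0r.
suff lim : (fun N : nat => \sum_(y <- r) alive N y * f y
    + \sum_(z <- r | `[< ~ L z >]) (\sum_(n < N) arrive n z) * f z) @ \oo -->
    \sum_(z <- r | `[< ~ L z >]) fine (P (exit_at z)) * f z.
  rewrite -(cvg_lim (@Rhausdorff R) lim) (_ : (fun N => _) = cst (f x)).
    by rewrite lim_cst.
  by apply/funext => N; exact: stopped_mean.
have limA : (fun N => \sum_(y <- r) alive N y * f y) @ \oo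
    --> \sum_(y <- r) 0 * f y.
  apply: (@cvg_big _ _ +%R 0 xpredT _ _ _ r (fun y n => alive n y * f y)) => [|y _].
    exact: add_continuous.
  exact: cvgMr_tmp (alive_vanish y).
have limB : (fun N => \sum_(z <- r | `[< ~ L z >]) (\sum_(n < N) arrive n z) * f z)
    @ \oo --> \sum_(z <- r | `[< ~ L z >]) fine (P (exit_at z)) * f z.
  apply: (@cvg_big _ _ +%R 0 (fun z => `[< ~ L z >]) _ _ _ r
    (fun z N => (\sum_(n < N) arrive n z) * f z)) => [|z /asboolP nL].
    exact: add_continuous.
  by apply: cvgMr_tmp; exact: exit_cvg.
rewrite [X in _ --> X]big1 in limA; last by move=> y _; rewrite mul0r.
by rewrite -[X in _ --> X]add0r; exact: cvgD limA limB.
Qed.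

Lemma cylinder_prob (h : nat -> site d) n : h 0%N = x ->
  P [set w | forall k, (k <= n)%N -> X k w = h k]
  = (\prod_(k < n) om (h k) (h k.+1 - h k))%:E.
Proof.
have [mX P0 step] := chain; move=> h0; elim: n => [|n IH].
  rewrite big_ord0 -P0 -h0; congr (P _); apply/seteqP; split => w /=.
    by apply.
  by move=> w0 [].
rewrite big_ord_recr /= EFinM -IH -step; congr (P _).
apply/seteqP; split => w /=.
  move=> wh; split; first by move=> k kn; apply: wh; rewrite leqW.
  by rewrite wh // addrC subrK.
move=> [wh wn] k; rewrite leq_eqVlt => /orP[/eqP ->|kn]; last exact: wh.
by rewrite wn addrC subrK.
Qed.

(** One trajectory that stays in [L] and then exits at [v] already has this mass. *)
Lemma exit_path (p : seq (site d)) (v : site d) (delta : R) : 0 <= delta ->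
  path (fun y z => delta <= om y (z - y)) x p ->
  (forall z, z \in p -> L z) -> ~ L v ->
  delta ^+ size p * om (last x p) (v - last x p) <= fine (P (exit_at v)).
Proof.
move=> delta0 /(pathP v) steps pL nLv; have [om0 _ _] := env.
pose h k := nth v (x :: p) k.
have hn : h (size p).+1 = v by rewrite /h nth_default.
have hl : h (size p) = last x p by rewrite /h (last_nth v).
rewrite -lee_fin fine_prob; last exact: measurable_exit_at.
have mC : measurable [set w | forall k, (k <= (size p).+1)%N -> X k w = h k].
  exact: measurable_cylinder chain _ _.
apply: (@le_trans _ _ (P [set w | forall k, (k <= (size p).+1)%N -> X k w = h k])).
  rewrite cylinder_prob // lee_fin big_ord_recr /= hn hl.
  rewrite ler_wpM2r // -[X in _ ^+ X]card_ord -prodr_const.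
  by apply: ler_prod => k _; rewrite delta0 /= /h; exact: steps.
apply: le_measure; rewrite ?inE //; first exact: measurable_exit_at.
move=> w /= wh; exists (size p).+1; split; last by rewrite wh ?hn.
apply/exit_timeP; split=> //; first by rewrite wh ?hn.
move=> [|k] // /andP[_ kp]; rewrite wh ?(ltnW kp) // /h /=.
by apply: pL; apply: mem_nth; rewrite ltnS in kp.
Qed.

End Killed.

(** * Orthant paths *)

Section Orthant.
Context {R : realType} {d : nat} (om : site d -> site d -> R).
Context (env : environment om) (bal : balanced om) (lazy : forall x, om x 0 = 0).
Context (d0 : (0 < d)%N).

Definition orthant (k x : site d) : set (site d) :=
  [set y | forall i, 0 <= k 0 i * (y - x) 0 i].

Local Notation delta := ((2 * d)%:R^-1 : R).

Lemma delta_gt0 : 0 < delta.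
Proof. by rewrite invr_gt0 ltr0n muln_gt0. Qed.

Lemma om_axis (k y : site d) i : square k -> om y (k 0 i *: e_ i) = om y (e_ i).
Proof.
by move=> sk; case: (sk i) => ->; rewrite ?scale1r ?scaleN1r // -bal.
Qed.

Lemma enorm_e (i : 'I_d) : enorm R (e_ i) = 1.
Proof.
rewrite /enorm (bigD1 i) //= coord_e eqxx big1 ?addr0 ?expr1n ?sqrtr1 //.
by move=> j /negPf ji; rewrite coord_e ji expr0n.
Qed.

Lemma enormN (v : site d) : enorm R (- v) = enorm R v.
Proof.
by congr Num.sqrt; apply: eq_bigr => i _; rewrite mxE rmorphN sqrrN.
Qed.

Lemma axis_E (k : site d) (i j : 'I_d) :
  (k 0 i *: (e_ i : site d)) 0 j = if j == i then k 0 i else 0.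
Proof. by rewrite mxE coord_e; case: eqP => _; rewrite ?mulr1 ?mulr0. Qed.

Lemma kstep_axis (k y : site d) i : square k ->
  kstep om k y (y + k 0 i *: e_ i) = (delta <= om y (e_ i)).
Proof.
move=> sk; rewrite /kstep addrC addKr om_axis //.
have -> : enorm R (k 0 i *: e_ i) == 1.
  by case: (sk i) => ->; rewrite ?scale1r ?scaleN1r ?enormN enorm_e.
rewrite /=; case: (delta <= _) => //=; apply/forallP => j; rewrite axis_E.
by case: eqP => [->|_]; [case: (sk i) => ->|rewrite mulr0].
Qed.

Lemma kstep_unit (k x y : site d) : square k -> kstep om k x y ->
  exists i, y = x + k 0 i *: e_ i.
Proof.
move=> sk /and3P[_ omxy /forallP orth].
have om0 : om x (y - x) != 0 by rewrite gt_eqF // (lt_le_trans delta_gt0).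
have [[i yi]|noi] := pselect (exists i, y - x = e_ i \/ y - x = - e_ i).
  exists i; rewrite -[LHS](subrK x) addrC; congr (_ + _).
  have := orth i; case: yi => ->; rewrite ?mxE ?eqxx /=;
    by case: (sk i) => -> //; rewrite ?scale1r ?scaleN1r.
case/eqP: om0; rewrite (om_jumps _ _ env lazy) big1 // => i _.
have [vi|_] := eqVneq (y - x) (e_ i); first by case: noi; exists i; left.
have [vi|_] := eqVneq (y - x) (- e_ i); first by case: noi; exists i; right.
by rewrite !mulr0 addr0.
Qed.

(** The [d] numbers [2 om y (e_ i)] add up to 1, so one of them is at least their
    average; orthant paths can thus be prolonged without end. *)
Lemma kstep_exists (k y : site d) : square k ->
  exists i, kstep om k y (y + k 0 i *: e_ i).
Proof.
move=> sk; apply: contrapT => noi.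
have := sum_om y env bal lazy; apply/eqP; rewrite lt_eqF //.
have one : (1 : R) = \sum_(i < d) delta * 2.
  rewrite sumr_const card_ord -mulr_natl natrM; field.
  by rewrite pnatr_eq0 -lt0n.
rewrite [X in _ < X]one; apply: ltr_sum.
  by apply/hasP; exists (Ordinal d0) => //; rewrite mem_index_enum.
move=> i _ /=; rewrite ltr_pM2r // ltNge -(kstep_axis y i sk); apply/negP => ki.
by apply: noi; exists i.
Qed.

Lemma orthant_refl (k x : site d) : orthant k x x.
Proof. by move=> i; rewrite subrr mxE mulr0. Qed.

Lemma orthant_trans (k x y z : site d) :
  orthant k x y -> orthant k y z -> orthant k x z.
Proof.
move=> xy yz i; rewrite -[z](subrK y) -addrA mxE mulrDr.
by rewrite addr_ge0.
Qed.

(** The coordinates move away from [x] monotonically, so no cancellation occurs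
    in the l1 distance. *)
Lemma kpath_orthant (k x : site d) p : square k -> path (kstep om k) x p ->
  orthant k x (last x p) /\ norm1 (x - last x p) = size p.
Proof.
move=> sk kp; pose phi (y z : site d) := \sum_(i < d) k 0 i * (z - y) 0 i.
have [orth phip] : orthant k x (last x p) /\ phi x (last x p) = (size p)%:Z.
  elim: p x kp => [|y p IH] x /=.
    move=> _; split; first exact: orthant_refl.
    by rewrite /phi big1 // => i _; rewrite subrr mxE mulr0.
  move=> /andP[xy /IH [orth phip]]; split.
    by apply: orthant_trans orth; case/and3P: xy => _ _ /forallP.
  have [j yj] := kstep_unit sk xy.
  have {}yj : y - x = k 0 j *: e_ j by rewrite yj addrC addKr.
  have -> : phi x (last y p) = phi x y + phi y (last y p).
    rewrite /phi -big_split; apply: eq_bigr => i _ /=.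
    by rewrite -mulrDr !mxE; congr (_ * _); ring.
  suff -> : phi x y = 1 by rewrite phip -PoszD.
  rewrite /phi (bigD1 j) //= big1 => [|i ij].
    by rewrite yj axis_E eqxx addr0; case: (sk j) => ->.
  by rewrite yj axis_E (negPf ij) mulr0.
split=> //; apply/eqP; rewrite -eqz_nat -phip /norm1 /phi; apply/eqP.
rewrite (big_morph Posz PoszD erefl); apply: eq_bigr => i _.
have := orth i; rewrite !mxE.
move: (x 0 i : int) (last x p 0 i : int) => a b; case: (sk i) => -> ab; lia.
Qed.

(** Along a monotone path a coordinate that ever moves ends up displaced, and
    the final displacement reveals its direction. Hence a path in one orthant
    that ends in another one is a path of the latter too. *)
Lemma kpath_change (k k' x : site d) p : square k -> square k' ->
  path (kstep om k') x p -> orthant k x (last x p) -> path (kstep om k) x p.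
Proof.
move=> sk sk'; elim: p x => // y p IH x /= /andP[xy yp] orth.
have [orth' _] := kpath_orthant sk' yp.
have /and3P[nxy omxy /forallP xy'] := xy.
have sgn i : 0 <= k 0 i * (y - x) 0 i /\ 0 <= k 0 i * (last y p - y) 0 i.
  have := orth i; have := orth' i; have := xy' i; rewrite !mxE.
  move: (x 0 i : int) (y 0 i : int) (last y p 0 i : int) => a b c.
  by case: (sk i) => ->; case: (sk' i) => ->; lia.
rewrite /kstep nxy omxy /=; apply/andP; split.
  by apply/forallP => i; case: (sgn i).
by apply: IH => // i; case: (sgn i).
Qed.

End Orthant.

(** * Exit points of percolation clusters *)

Lemma normoo_le (d : nat) (v : site d) (N : nat) :
  (normoo v <= N)%N <-> forall i, (`|v 0%R i| <= N)%N.
Proof.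
by split=> [/bigmax_leqP vN i|vN]; [apply: vN|apply/bigmax_leqP => i _].
Qed.

Lemma bounded_setU (d : nat) (A B : set (site d)) :
  bounded_sites A -> bounded_sites B -> bounded_sites (A `|` B).
Proof.
move=> [N AN] [M BM]; exists (maxn N M) => x [/AN|/BM] xN.
  by rewrite leq_max xN.
by rewrite leq_max xN orbT.
Qed.

Lemma bounded_boundary (d : nat) (A : set (site d)) :
  bounded_sites A -> bounded_sites (boundary A).
Proof.
move=> [N AN]; exists N.+1 => y [_ [x /AN /normoo_le xN xy]].
apply/normoo_le => i; have := xN i.
have /normoo_le/(_ i) : (normoo (x - y) <= 1)%N by rewrite xy.
by rewrite !mxE; move: (x 0 i : int) (y 0 i : int) => a b; lia.
Qed.

Lemma bounded_finite (d : nat) (B : set (site d)) : bounded_sites B -> finite_set B.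
Proof.
move=> [N BN].
pose f (M : 'M['I_(2 * N).+1]_(1, d)) : site d :=
  map_mx (fun k : 'I_(2 * N).+1 => (k : nat)%:Z - N%:Z) M.
apply: (@sub_finite_set _ _ (f @` setT)).
  move=> x /BN /normoo_le xN.
  exists (\matrix_(a, i) inord (absz (x 0 i + N%:Z))) => //.
  apply/matrixP => a i; rewrite !mxE !ord1; have := xN i.
  move: (x 0 i : int) => b bN; rewrite inordK; lia.
exact/finite_image/finite_finset.
Qed.

Section Percolation.
Context {R : realType} {d : nat} (om : site d -> site d -> R) (eps0 : R).
Context (env : environment om) (bal : balanced om) (lazy : forall x, om x 0 = 0).
Context (d0 : (0 < d)%N) (eps_gt0 : 0 < eps0).
Context (fin_ell : forall x, (ell om eps0 x < +oo)%E).
Context (Y : site d -> site d -> site d) (selY : selection om eps0 Y).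

Local Notation delta := ((2 * d)%:R^-1 : R).
Local Notation Lam := (Lambda om eps0 Y).

Lemma cluster_bounded x : open_site om eps0 x ->
  bounded_sites (cluster om eps0 x).
Proof.
move=> ox; have := fin_ell x; rewrite /ell ox /l1_diam.
by case: asboolP.
Qed.

Lemma Lambda_sub x : Lam x `<=` bar (cluster om eps0 x).
Proof. by move=> z [k [p [_ [_ _ pbar] zp]]]; exact: pbar. Qed.

Lemma Lambda_closed x : ~~ open_site om eps0 x -> Lam x = set0.
Proof.
move=> cx; apply/seteqP; split => // z /Lambda_sub [[]|].
  by rewrite (negPf cx).
by move=> [_ [y []]]; rewrite (negPf cx).
Qed.

Lemma Lambda_finite x : finite_set (Lam x).
Proof.
have [ox|cx] := boolP (open_site om eps0 x); last by rewrite Lambda_closed.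
apply: sub_finite_set (@Lambda_sub x) _; apply: bounded_finite.
by apply: bounded_setU; [|apply: bounded_boundary]; exact: cluster_bounded.
Qed.

Lemma closed_ge (z : site d) i : ~~ open_site om eps0 z -> eps0 <= om z (e_ i).
Proof.
rewrite /open_site -leNgt => /le_trans; apply.
exact: bigmin_le_cond.
Qed.

(** At a closed site the [2 d] directions of probability at least [eps0] share a
    total mass of 1. *)
Lemma closed_eps (z : site d) : ~~ open_site om eps0 z -> eps0 <= delta.
Proof.
move=> cz; have := sum_om z env bal lazy.
have : \sum_(i < d) eps0 * 2 <= \sum_(i < d) om z (e_ i) * 2.
  by apply: ler_sum => i _; rewrite ler_pM2r // closed_ge.
move=> /[swap] ->; rewrite sumr_const card_ord -mulr_natl => le1.
by rewrite -div1r ler_pdivlMr ?ltr0n ?muln_gt0 // natrM; lra.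
Qed.

(** Orthant paths inside [Lambda_x]: these are the paths that the walk can
    follow without exiting. *)
Definition inner (x k : site d) (p : seq (site d)) : Prop :=
  path (kstep om k) x p /\ forall z, z \in x :: p -> Lam x z.

(** This is where the maximality of the selected site [y_kappa] enters. *)
Lemma inner_size x k p : open_site om eps0 x -> square k -> inner x k p ->
  (size p <= norm1 (x - Y x k))%N.
Proof.
move=> ox sk [kp pL]; have [_ <-] := kpath_orthant env lazy d0 sk kp.
have [_ _ maxY] := selY ox sk; apply: (maxY _ p); split=> //.
by move=> z /pL; exact: Lambda_sub.
Qed.

Lemma inner_prefix x k p1 p2 : inner x k (p1 ++ p2) -> inner x k p1.
Proof.
move=> [+ pL]; rewrite cat_path => /andP[kp1 _]; split=> // z zp.
by apply: pL; rewrite -cat_cons mem_cat zp.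
Qed.

Lemma inner_selected x k : open_site om eps0 x -> square k ->
  exists p, inner x k p /\ last x p = Y x k.
Proof.
move=> ox sk; have [_ [p kp] _] := selY ox sk; exists p.
have [kpp pY _] := kp; split=> //; split=> // z zp.
by exists k, p.
Qed.

(** If all sites of the path were open, its edges would be open and the path
    would not leave the cluster. *)
Lemma closed_on_path x k p : open_site om eps0 x -> path (kstep om k) x p ->
  ~ cluster om eps0 x (last x p) ->
  exists p1 p2, p = p1 ++ p2 /\ ~~ open_site om eps0 (last x p1).
Proof.
move=> ox kp ncl; have [op|] := boolP (all (open_site om eps0) (x :: p)).
  case: ncl; split=> //; exists p; split=> //.
  elim: p x {ox} kp op => // y p IH x /= /andP[xy yp] /and3P[ox oy op].
  rewrite /open_edge ox oy; case/and3P: xy => -> _ _ /=.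
  by apply: IH => //=; rewrite oy.
rewrite -has_predC => /hasP[z zp cz].
by case/splitPl: zp cz => p1 p2 <- cz; exists p1, p2.
Qed.

Lemma selected_le_ell x k : open_site om eps0 x -> square k ->
  (2 * d)%:R ^+ norm1 (x - Y x k) <= (2 * d)%:R `^ fine (ell om eps0 x) :> R.
Proof.
move=> ox sk; have [bY _ _] := selY ox sk.
rewrite -powR_mulrn ?ler0n // ler_powR ?ler1n ?muln_gt0 //.
have fe := fin_ell x.
have le : ((norm1 (x - Y x k))%:R%:E <= ell om eps0 x)%E.
  rewrite /ell ox /l1_diam asboolT; last exact: cluster_bounded.
  apply: ereal_sup_ubound; exists x; first by split=> //; exists [::].
  by exists (Y x k).
rewrite -lee_fin fineK // fin_numE.
by apply/andP; split; [apply/eqP => E; rewrite E in le|rewrite lt_eqF].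
Qed.

Context (x : site d) (a : site d -> R).
Context (a_path : forall p v,
  path (fun y z => delta <= om y (z - y)) x p ->
  (forall z, z \in p -> Lam x z) -> ~ Lam x v ->
  delta ^+ size p * om (last x p) (v - last x p) <= a v).

Lemma a_inner k p v : inner x k p -> ~ Lam x v ->
  delta ^+ size p * om (last x p) (v - last x p) <= a v.
Proof.
move=> [kp pL] nv; apply: a_path => //.
  by apply: sub_path kp => y z /and3P[].
by move=> z zp; apply: pL; rewrite inE zp orbT.
Qed.

Lemma delta_ge0 : 0 <= delta. Proof. exact/ltW/delta_gt0. Qed.

Lemma delta_le1 : delta <= 1.
Proof. by rewrite invf_le1 ?ltr0n ?ler1n muln_gt0. Qed.

(** Prolonging an orthant path by steps of probability at least [1/(2d)] must end
    outside [Lambda_x], since the length of the paths inside is bounded. *)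
Lemma inner_exit k p : open_site om eps0 x -> square k -> inner x k p ->
  exists v, orthant k (last x p) v /\ delta ^+ (norm1 (x - Y x k)).+1 <= a v.
Proof.
move=> ox sk; set N := norm1 _.
have [m] := ubnP (N - size p)%N; elim: m p => // m IH p pm ip.
have [i ki] := kstep_exists env bal lazy d0 (last x p) sk.
set z := last x p + _ in ki.
have /and3P[_ omz /forallP oz] := ki.
have [Lz|nz] := pselect (Lam x z).
  have iz : inner x k (rcons p z).
    case: ip => kp pL; split; first by rewrite rcons_path kp ki.
    by move=> y; rewrite -rcons_cons mem_rcons inE => /predU1P[->//|]; exact: pL.
  have := inner_size ox sk iz; rewrite size_rcons -/N => pN.
  have [||v []] := IH (rcons p z); rewrite ?size_rcons ?last_rcons //.
    by move: pm pN; lia.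
  by move=> zv av; exists v; split=> //; exact: orthant_trans oz zv.
exists z; split=> //; apply: le_trans (a_inner ip nz).
apply: le_trans (ler_wpM2l (exprn_ge0 _ delta_ge0) omz).
rewrite -exprSr; apply: ler_wiXn2l; [exact: delta_ge0|exact: delta_le1|].
by rewrite ltnS; exact: inner_size.
Qed.

(** In each orthant, and for each direction, the walk exits [Lambda_x] with
    probability at least [eps0 / (2d)^(l_x)] at a site displaced in that
    direction. *)
Lemma exit_orthant k j : square k ->
  exists v, [/\ orthant k x v, 1 <= k 0 j * (v - x) 0 j
    & eps0 <= a v * (2 * d)%:R `^ fine (ell om eps0 x)].
Proof.
move=> sk.
have far y z : orthant k x y -> orthant k (y + k 0 j *: e_ j) z ->
    orthant k x z /\ 1 <= k 0 j * (z - x) 0 j.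
  move=> xy yz; have yj : orthant k y (y + k 0 j *: e_ j).
    move=> i; rewrite addrC addKr axis_E; case: eqP => [->|_]; last by rewrite mulr0.
    by case: (sk j) => ->.
  split; first exact: orthant_trans (orthant_trans xy yj) yz.
  have := xy j; have := yz j; rewrite !mxE !eqxx.
  move: (x 0 j : int) (y 0 j : int) (z 0 j : int) => a0 b c.
  by case: (sk j) => ->; rewrite /=; lia.
have [ox|cx] := boolP (open_site om eps0 x); last first.
  exists (x + k 0 j *: e_ j).
  have [| |xv fv] := far x (x + k 0 j *: e_ j); [exact: orthant_refl..|].
  split=> //; rewrite /ell (negPf cx) /= powRr0 mulr1.
  have := @a_path [::] (x + k 0 j *: e_ j) isT.
  rewrite /= expr0 mul1r [_ + _ - x]addrC addKr om_axis // Lambda_closed // => av.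
  by apply: le_trans (closed_ge j cx) (av _ _) => // z.
have [p [ip pY]] := inner_selected ox sk.
have [bY _ _] := selY ox sk.
have [||p1 [p2 [pE cz]]] := @closed_on_path x k p ox;
  [by case: ip|by rewrite pY; case: bY|].
rewrite {}pE in ip pY; have ip1 := inner_prefix ip.
have [xz _] := kpath_orthant env lazy d0 sk ip1.1.
have p1N := inner_size ox sk ip1.
set z := last x p1 in cz xz; pose w := z + k 0 j *: e_ j.
set N := norm1 (x - Y x k) in p1N.
have N0 : 0 < (2 * d)%:R ^+ N :> R by rewrite exprn_gt0 // ltr0n muln_gt0.
have scale b : delta ^+ N * eps0 <= b ->
    eps0 <= b * (2 * d)%:R `^ fine (ell om eps0 x).
  move=> ab; have b0 : 0 <= b.
    by apply: le_trans ab; rewrite mulr_ge0 ?exprn_ge0 ?delta_ge0 ?ltW.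
  apply: le_trans (ler_wpM2l b0 (selected_le_ell ox sk)).
  by rewrite -ler_pdivrMr // mulrC -exprVn.
have [Lw|nLw] := pselect (Lam x w); last first.
  (* the walk exits right after the closed site *)
  exists w; have [|xw fw] := far z w xz; first exact: orthant_refl.
  split=> //; apply: scale; apply: le_trans (a_inner ip1 nLw).
  rewrite /w [_ + _ - _]addrC addKr om_axis //.
  apply: ler_pM; [exact/exprn_ge0/delta_ge0|exact: ltW| |exact: closed_ge].
  by apply: ler_wiXn2l; [exact: delta_ge0|exact: delta_le1|].
(* [w] lies on some selected path, in a possibly different orthant [k'] *)
have [k' [p' [sk' kp' wp']]] := Lw.
case/splitPl: wp' kp' => q1 q2 qw kp'.
have iq : inner x k' q1.
  apply: (@inner_prefix _ _ q1 q2); have [kp _ _] := kp'; split=> // y yp.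
  by exists k', (q1 ++ q2).
have xw : orthant k x w by case: (far z w xz (@orthant_refl _ k w)).
have iqk : inner x k q1.
  case: iq => kq qL; split=> //.
  by apply: (kpath_change env lazy d0 sk sk' kq); rewrite qw.
have [v [qv av]] := inner_exit ox sk iqk; rewrite qw in qv.
exists v; have [xv fv] := far z v xz qv; split=> //; apply: scale.
apply: le_trans av; rewrite exprSr ler_wpM2l ?exprn_ge0 ?delta_ge0 //.
exact: closed_eps cz.
Qed.

End Percolation.

(** * Covering a cube *)

Lemma card_bounded_gap (R : realType) (N : nat) (h c : R) (T : {set 'I_N}) :
  0 < h -> 0 <= c ->
  (forall a b : 'I_N, a \in T -> b \in T -> h * (b%:R - a%:R) <= c) ->
  #|T|%:R <= c / h + 1.
Proof.
move=> h0 c0 gap; have [->|[i0 i0T]] := set_0Vmem T.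
  by rewrite cards0 addr_ge0 // divr_ge0 // ltW.
have [a aT amin] := @arg_minnP _ i0 (mem T) (@nat_of_ord N) i0T.
have [b bT bmax] := @arg_maxnP _ i0 (mem T) (@nat_of_ord N) i0T.
have ab : (a <= b)%N by apply: amin.
have cardT : (#|T| <= (b - a).+1)%N.
  (* the values of [T] lie in the interval from [a] to [b] *)
  pose f (i : 'I_N) : 'I_(b - a).+1 := inord (i - a).
  have injf : {in T &, injective f}.
    move=> i j iT jT /(congr1 (@nat_of_ord _)).
    have := amin _ iT; have := amin _ jT; have := bmax _ iT; have := bmax _ jT.
    move=> /= jb ib aj ai; rewrite !inordK; [|lia|lia].
    by move=> ij; apply: val_inj => /=; lia.
  by rewrite -(card_in_imset injf) -[leqRHS]card_ord; exact: max_card.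
have := gap _ _ aT bT; rewrite -natrB // mulrC -ler_pdivlMr // => gapab.
rewrite (le_trans (y := (b - a).+1%:R)) ?ler_nat //.
by rewrite -natr1 lerD2r.
Qed.

(** Discretised volume comparison: of the [N^d] points of a regular grid of mesh
    [h = 2m/N], a set of coordinate widths at most [c] holds at most
    [(c/h + 1)^d]. *)
Lemma grid_count (R : realType) (d : nat) (T : eqType) (r : seq T)
    (m : R) (C : T -> set 'rV[R]_d) (c : T -> R) (n : nat) :
  0 < m -> (forall t, t \in r -> 0 <= c t) ->
  (forall t p q j, t \in r -> C t p -> C t q -> q 0 j - p 0 j <= c t) ->
  (forall p : 'rV[R]_d, (forall j, `|p 0 j| <= m) ->
     exists2 t, t \in r & C t p) ->
  1 <= \sum_(t <- r) (c t / (2 * m) + n.+1%:R^-1) ^+ d.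
Proof.
move=> m0 c0 gap cover.
set N := n.+1; have N0 : 0 < N%:R :> R by rewrite ltr0n.
have N0' : N%:R != 0 :> R by rewrite gt_eqF.
pose h : R := 2 * m / N%:R; have h0 : 0 < h by rewrite divr_gt0 // mulr_gt0.
pose pt (k : {ffun 'I_d -> 'I_N}) : 'rV[R]_d := \row_j (h * (k j)%:R - m).
pose S t : {set {ffun 'I_d -> 'I_N}} := finset (fun k => `[< C t (pt k) >]).
have cardS t : t \in r -> #|S t|%:R <= (c t / h + 1) ^+ d.
  move=> tr; pose F j : {set 'I_N} := [set k j | k : {ffun 'I_d -> 'I_N} in S t]%SET.
  have FS : S t \subset family F.
    apply/fintype.subsetP => k kS; apply/familyP => j.
    by rewrite /F; apply/imsetP; exists k.
  rewrite (le_trans (y := #|family F|%:R)) ?ler_nat ?subset_leq_card //.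
  rewrite card_family foldrE big_map big_enum /= natr_prod.
  rewrite -[X in _ ^+ X]card_ord -prodr_const; apply: ler_prod => j _.
  rewrite ler0n /=; apply: card_bounded_gap => //; first exact: c0.
  move=> a b /imsetP[ka kaS ->] /imsetP[kb kbS ->].
  move: kaS kbS; rewrite !finset.in_set => /asboolP Ca /asboolP Cb.
  have := gap t (pt ka) (pt kb) j tr Ca Cb.
  by rewrite !mxE; apply: le_trans; rewrite le_eqVlt; apply/orP; left; apply/eqP; ring.
have count : N%:R ^+ d <= \sum_(t <- r) #|S t|%:R :> R.
  rewrite -natr_sum -natrX ler_nat -{1}[N]card_ord -{1}[d]card_ord -card_ffun.
  rewrite -sum1_card.
  under [leqRHS]eq_bigr do rewrite -sum1_card big_mkcond /=.
  rewrite exchange_big /=; apply: leq_sum => k _.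
  have [j|t tr Ct] := cover (pt k).
    rewrite mxE ler_norml; have kN : (k j)%:R <= N%:R :> R.
      by rewrite ler_nat ltnW.
    have -> : h * (k j)%:R = 2 * m * ((k j)%:R / N%:R).
      by rewrite /h mulrAC -mulrA.
    have k0 : 0 <= (k j)%:R / N%:R :> R by rewrite divr_ge0.
    have k1 : (k j)%:R / N%:R <= 1 :> R by rewrite ler_pdivrMr // mul1r.
    apply/andP; split; nra.
  rewrite (big_rem _ tr) /= ifT ?leq_addr // finset.in_set; exact/asboolP.
rewrite -(ler_pM2r (exprn_gt0 d N0)) mul1r mulr_suml.
apply: le_trans count _; rewrite big_seq [leRHS]big_seq.
apply: ler_sum => t tr; rewrite -exprMn; apply: le_trans (cardS t tr) _.
suff -> : (c t / (2 * m) + N%:R^-1) * N%:R = c t / h + 1 by [].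
by rewrite /h; field; rewrite N0' gt_eqF.
Qed.

(** The volume of a cube is at most the total volume of the boxes that cover it.
    Refining the grid of [grid_count] proves it without Lebesgue measure. *)
Lemma cube_cover (R : realType) (d : nat) (T : eqType) (r : seq T)
    (m : R) (C : T -> set 'rV[R]_d) (c : T -> R) :
  0 < m -> (forall t, t \in r -> 0 <= c t) ->
  (forall t p q j, t \in r -> C t p -> C t q -> q 0 j - p 0 j <= c t) ->
  (forall p : 'rV[R]_d, (forall j, `|p 0 j| <= m) ->
     exists2 t, t \in r & C t p) ->
  (2 * m) ^+ d <= \sum_(t <- r) c t ^+ d.
Proof.
move=> m0 c0 gap cover.
have m20 : 0 < 2 * m by rewrite mulr_gt0.
have lim : (fun n => \sum_(t <- r) (c t / (2 * m) + n.+1%:R^-1) ^+ d)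
    @ \oo --> \sum_(t <- r) (c t / (2 * m)) ^+ d.
  apply: (@cvg_big _ _ +%R 0 xpredT _ _ _ r
    (fun t n => (c t / (2 * m) + n.+1%:R^-1) ^+ d)) => [|t _].
    exact: add_continuous.
  have lim1 : (fun n => c t / (2 * m) + n.+1%:R^-1) @ \oo --> c t / (2 * m).
    rewrite -[X in _ --> X]addr0; apply: cvgD; first exact: cvg_cst.
    exact: cvg_harmonic.
  apply: (@continuous_cvg _ _ _ _ _ _ (fun x : R => x ^+ d) _ _ lim1).
  exact: exprn_continuous.
have le1 : 1 <= \sum_(t <- r) (c t / (2 * m)) ^+ d.
  apply: cvgr_to_ge lim _; near=> n; exact: grid_count gap cover.
have m2d : 0 <= (2 * m) ^+ d by rewrite exprn_ge0 // ltW.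
rewrite -[leLHS]mulr1; apply: le_trans (ler_wpM2l m2d le1) _.
rewrite mulr_sumr; apply: ler_sum => t _.
by rewrite -exprMn mulrC divfK ?gt_eqF.
Unshelve. all: by end_near.
Qed.

(** * The maximum principle for a centred jump kernel *)

Lemma seq_argmax (R : realType) (T : eqType) (r : seq T) (f : T -> R) x0 :
  x0 \in r -> exists2 x, x \in r & forall y, y \in r -> f y <= f x.
Proof.
elim: r x0 => // z s IH x0 _.
case: s IH => [|z' s] IH.
  by exists z => [|y]; rewrite inE // => /eqP ->.
have [|x xs xmax] := IH z'; first by rewrite inE eqxx.
have [fz|fz] := leP (f z) (f x).
  exists x => [|y]; first by rewrite inE xs orbT.
  by rewrite inE => /predU1P[->|/xmax].
exists z => [|y]; first by rewrite inE eqxx.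
by rewrite inE => /predU1P[->|/xmax /le_trans]; [|apply; exact: ltW].
Qed.

Lemma finite_argmax (R : realType) (T : choiceType) (A : set T) (f : T -> R) :
  finite_set A -> A !=set0 -> exists2 x, A x & forall y, A y -> f y <= f x.
Proof.
move=> finA [x0 Ax0].
have memA y : (y \in finmap.enum_fset (fset_set A)) = (y \in A) by exact: in_fset_set.
have [|x xA xmax] := @seq_argmax R _ (finmap.enum_fset (fset_set A)) f x0.
  by rewrite memA inE.
exists x => [|y Ay]; first by move: xA; rewrite memA inE.
by apply: xmax; rewrite memA inE.
Qed.

Lemma finite_has_ubound (R : realType) (A : set R) :
  finite_set A -> has_ubound A.
Proof.
move=> finA; have [->|/set0P A0] := eqVneq A set0; first by exists 0.
by have [x _ xmax] := finite_argmax id finA A0; exists x.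
Qed.

Lemma Lop_sum (R : realType) (d : nat) (a : site d -> site d -> R)
    (r : seq (site d)) (f : site d -> R) x :
  uniq r -> (forall z, z \notin r -> a x z = 0) ->
  Lop a f x = \sum_(z <- r) a x z * (f z - f x).
Proof.
move=> ur ar; rewrite /Lop (fsbigE r) //; last by move=> z _ zr; rewrite ar ?mul0r.
by apply: eq_bigl => z; rewrite in_setT.
Qed.

Lemma powR_root (R : realType) (m : R) (d : nat) : 0 <= m -> (0 < d)%N ->
  (m ^+ d) `^ (d%:R^-1) = m.
Proof.
by move=> m0 d0; rewrite -powR_mulrn // -powRrM divff ?powRr1 // pnatr_eq0 -lt0n.
Qed.

Section MaximumPrinciple.
Context {R : realType} {d : nat} (a : site d -> site d -> R) (W : site d -> R).
Context (d0 : (0 < d)%N).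
Context (a_ge0 : forall x z, 0 <= a x z) (W_gt0 : forall x, 0 < W x).
Context (centred : forall x, exists r : seq (site d), [/\ uniq r,
  forall z, z \notin r -> a x z = 0
  & forall s, \sum_(z <- r) a x z * (dot s z - dot s x) = 0]).
Context (reach : forall x k j, square k -> exists v,
  [/\ orthant k x v, 1 <= k 0 j * (v - x) 0 j & 1 <= a x v * W x]).
Context (E : set (site d)) (finE : finite_set E) (u g : site d -> R).
Context (super : forall x, E x -> Iu a u E x !=set0 -> Lop a u x >= - g x).

Lemma reach_gt0 x v : 1 <= a x v * W x -> 0 < a x v.
Proof.
move=> av; rewrite lt_neqAle a_ge0 andbT; apply/eqP => a0.
by move: av; rewrite -a0 mul0r ler10.
Qed.

(** Subtracting from [u] the linear function [dot s] does not change [Lop a u x],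
    and turns all terms of [Lop] into nonpositive ones. *)
Lemma drop_le x s v : E x -> Iu a u E x s ->
  a x v * ((u x - dot s x) - (u v - dot s v)) <= g x.
Proof.
move=> Ex Is; have [r [ur ar cr]] := centred x.
have := super Ex (ex_intro _ s Is); rewrite (Lop_sum _ ur ar).
pose w z := u z - dot s z.
have w_le z : a x z * (w z - w x) <= 0.
  have [->|az] := eqVneq (a x z) 0; first by rewrite mul0r.
  rewrite mulr_ge0_le0 // subr_le0; apply: Is.
  have [Ez|nEz] := pselect (E z); [by left|right; split=> //].
  by exists x; rewrite // lt_neqAle eq_sym az a_ge0.
have -> : \sum_(z <- r) a x z * (u z - u x) = \sum_(z <- r) a x z * (w z - w x).
  rewrite -[RHS]addr0 -[X in _ = _ + X](cr s) -big_split; apply: eq_bigr => z _ /=.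
  by rewrite -mulrDr /w; congr (_ * _); ring.
have [vr|vr] := boolP (v \in r).
  rewrite (big_rem _ vr) /= -/(w x) -/(w v) => sum_ge.
  have rest : \sum_(z <- rem v r) a x z * (w z - w x) <= 0.
    by apply: sumr_le0 => z _.
  have -> : a x v * (w x - w v) = - (a x v * (w v - w x)) by ring.
  lra.
rewrite (ar v vr) mul0r => sum_ge.
have : \sum_(z <- r) a x z * (w z - w x) <= 0 by apply: sumr_le0.
lra.
Qed.

(** The site [v] is chosen in the orthant opposite to the signs of [q - p]. In
    this way all the terms of [(q - p) (x - v)] are nonnegative, and the [j]-th
    one is at least [q_j - p_j]. *)
Lemma slope_gap x p q j : E x -> Iu a u E x p -> Iu a u E x q ->
  q 0 j - p 0 j <= `|g x * W x|.
Proof.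
move=> Ex Ip Iq; apply: le_trans (ler_norm _).
pose k : site d := \row_i (if 0 <= q 0 i - p 0 i then -1 else 1).
have sk : square k by move=> i; rewrite mxE; case: ifP; [right|left].
have [v [xv fv av]] := reach x j sk.
have Ev : Etilde a E v.
  have [Ev|nEv] := pselect (E v); [by left|right; split=> //].
  by exists x => //; exact: reach_gt0.
pose drop := (u x - dot p x) - (u v - dot p v).
have drop_ge : q 0 j - p 0 j <= drop.
  have /(_ v Ev) := Iq; rewrite /drop => qv.
  have terms i : 0 <= (q 0 i - p 0 i) * ((x 0 i)%:~R - (v 0 i)%:~R).
    have := xv i; rewrite !mxE -intrB; case: ifP => [qp|/negbT].
      by rewrite mulN1r opprB => xvi; rewrite mulr_ge0 // ler0z.
    by rewrite -ltNge mul1r subr_ge0 => /ltW qp xvi; rewrite mulr_le0 // lerz0 subr_le0.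
  have gain : q 0 j - p 0 j <=
      \sum_(i < d) (q 0 i - p 0 i) * ((x 0 i)%:~R - (v 0 i)%:~R).
    rewrite (bigD1 j) //= -[leLHS]addr0; apply: lerD; last first.
      by apply: sumr_ge0 => i _.
    have := fv; rewrite !mxE -intrB; case: ifP => [qp|/negbT].
      by rewrite mulN1r opprB => xvi; rewrite ler_peMr // ler1z.
    rewrite -ltNge => qp _; apply: le_trans (ltW qp) _.
    by have := terms j; rewrite intrB.
  have : \sum_(i < d) (q 0 i - p 0 i) * ((x 0 i)%:~R - (v 0 i)%:~R)
      = (dot q x - dot p x) - (dot q v - dot p v).
    rewrite /dot -!sumrB; apply: eq_bigr => i _; ring.
  move=> dots; lra.
have drop0 : 0 <= drop by rewrite subr_ge0; exact: Ip.
apply: le_trans drop_ge _.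
apply: (@le_trans _ _ (drop * (a x v * W x))); first by rewrite ler_peMr.
rewrite mulrA [drop * _]mulrC; apply: ler_wpM2r; first exact: ltW.
exact: drop_le Ex Ip.
Qed.

Lemma Eb_finite : finite_set (Eb a E).
Proof.
pose S x := [set` projT1 (cid (centred x))].
apply: (@sub_finite_set _ _ (\bigcup_(x in E) S x)).
  move=> y [_ [x Ex axy]]; exists x => //; rewrite /S /=.
  case: cid => r [_ ar _] /=; apply/negPn/negP => yr.
  by rewrite ar ?ltxx in axy.
by apply: bigcup_finite => // x _; exact: finite_seq.
Qed.

(** From a rightmost site of [E] the kernel jumps further to the right. So the
    supremum over [E^b] is a genuine maximum and not the value 0 that [sup]
    takes on the empty set. *)
Lemma Eb_nonempty : E !=set0 -> Eb a E !=set0.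
Proof.
move=> E0; pose j := Ordinal d0.
have [x Ex xmax] := finite_argmax (fun x : site d => (x 0 j)%:~R : R) finE E0.
have sk : square (const_mx 1 : site d) by move=> i; rewrite mxE; left.
have [v [_ fv av]] := reach x j sk.
exists v; split; last by exists x => //; exact: reach_gt0.
move=> /xmax; rewrite ler_int; move: fv; rewrite !mxE.
by move: (x 0 j : int) (v 0 j : int) => b c; lia.
Qed.

Lemma Etilde_finite : finite_set (Etilde a E).
Proof. by rewrite finite_setU; split=> //; exact: Eb_finite. Qed.

Lemma diam_has_ubound :
  has_ubound [set ((normoo (x - y))%:R : R) | x in Etilde a E & y in Etilde a E].
Proof.
by apply/finite_has_ubound/finite_image2; exact: Etilde_finite.
Qed.

Lemma le_diam x y : Etilde a E x -> Etilde a E y ->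
  (normoo (x - y))%:R <= diam a E.
Proof.
by move=> Ex Ey; apply: (ub_le_sup diam_has_ubound); exists x => //; exists y.
Qed.

Lemma dot_le (s : 'rV[R]_d) (x y : site d) (m D : R) : 0 <= m ->
  (forall j, `|s 0 j| <= m) -> (normoo (x - y))%:R <= D ->
  dot s x - dot s y <= d%:R * m * D.
Proof.
move=> m0 sm xyD; rewrite /dot -sumrB.
apply: (@le_trans _ _ (\sum_(i < d) m * D)).
  apply: ler_sum => i _; rewrite -mulrBr; apply: le_trans (ler_norm _) _.
  rewrite normrM; apply: ler_pM => //; apply: le_trans xyD.
  have /normoo_le/(_ i) := leqnn (normoo (x - y)).
  by rewrite !mxE -(ler_nat R) natr_absz -intrB intr_norm.
by rewrite sumr_const card_ord -[leLHS]mulr_natl mulrA.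
Qed.

(** A slope too small to make up for the gap between the maxima over [E] and over
    its boundary supports [u] from above at a site of [E]. *)
Lemma slopes_cover x0 (m : R) (s : 'rV[R]_d) : E x0 -> 0 <= m ->
  (forall j, `|s 0 j| <= m) ->
  d%:R * m * diam a E <= u x0 - sup [set u y | y in Eb a E] ->
  exists2 x, E x & Iu a u E x s.
Proof.
move=> Ex0 m0 sm small.
have Ex0' : Etilde a E x0 by left.
have [z Ez zmax] := finite_argmax (fun z => u z - dot s z) Etilde_finite
  (ex_intro _ x0 Ex0').
have [Ez'|Ebz] := Ez; first by exists z.
exists x0 => // y /zmax; move=> /le_trans; apply.
have uz : u z <= sup [set u y | y in Eb a E].
  apply: ub_le_sup; last by exists z.
  exact/finite_has_ubound/finite_image/Eb_finite.
have := dot_le m0 sm (le_diam Ex0' Ez); lra.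
Qed.

Lemma diam_ge0 : 0 <= diam a E.
Proof.
have [E0|/set0P[x Ex]] := eqVneq E set0.
  rewrite /diam (_ : [set _ | _ in _ & _ in _] = set0) ?sup0 //.
  have nE z : E z -> False by rewrite E0; case.
  by apply/seteqP; split => // _ [x [/nE|[_ [z /nE]]] //].
by apply: le_trans (le_diam (or_introl Ex) (or_introl Ex)); rewrite ler0n.
Qed.

(** The estimate for any centred kernel with finite jumps that reaches, from each
    [x], each orthant and each direction with mass at least [1 / W x]. *)
Theorem maximum_principle :
  sup [set u x | x in E] <=
    d%:R * diam a E
      * (\sum_(x \in [set x | E x /\ Iu a u E x !=set0])
           `|g x * W x| ^+ d) `^ (d%:R^-1)
    + sup [set u y | y in Eb a E].
Proof.
set S := \sum_(x \in _) _; set B := sup [set u y | y in Eb a E].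
have dD0 : 0 <= d%:R * diam a E by rewrite mulr_ge0 ?diam_ge0.
have rhs0 : 0 <= d%:R * diam a E * S `^ (d%:R^-1) by rewrite mulr_ge0 ?powR_ge0.
have [E0|/set0P Ene] := eqVneq E set0.
  have Eb0 : Eb a E = set0.
    by apply/seteqP; split => // y [_ [x]]; rewrite E0; case.
  by rewrite /B Eb0 E0 !image_set0 !sup0 addr0 -E0.
have [x0 Ex0 x0max] := finite_argmax u finE Ene.
have -> : sup [set u x | x in E] = u x0.
  apply/eqP; rewrite eq_le; apply/andP; split.
    by apply: ge_sup => [|_ [y Ey <-]]; [exists (u x0); exists x0|exact: x0max].
  by apply: ub_le_sup; [exact/finite_has_ubound/finite_image|exists x0].
have [M0|M0] := leP (u x0 - B) 0; first by lra.
have [y Eby] := Eb_nonempty Ene.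
have D0 : 0 < diam a E.
  apply: lt_le_trans (le_diam (or_introl Ex0) (or_intror Eby)).
  rewrite ltr0n lt0n; apply/eqP => xy; case: Eby => nEy _; apply: nEy.
  have /normoo_le xy0 : (normoo (x0 - y) <= 0)%N by rewrite xy.
  suff -> : y = x0 by [].
  apply/matrixP => i j; rewrite ord1; have := xy0 j; rewrite !mxE.
  by move: (x0 0 j : int) (y 0 j : int) => b c; lia.
have dr0 : 0 < d%:R :> R by rewrite ltr0n.
pose m := (u x0 - B) / (d%:R * diam a E).
have m0 : 0 < m by rewrite divr_gt0 // mulr_gt0.
have mE : d%:R * m * diam a E = u x0 - B.
  by rewrite /m; field; rewrite !gt_eqF.
pose E' := [set x | E x /\ Iu a u E x !=set0].
have finE' : finite_set E' by apply: sub_finite_set finE => x [].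
have vol : (2 * m) ^+ d <= S.
  rewrite /S fsbig_finite //.
  apply: (@cube_cover _ _ _ _ _ (fun x => Iu a u E x)) => //.
    move=> x p q j; rewrite in_fset_set // inE => -[Ex _]; exact: slope_gap.
  move=> s sm; have [|x Ex Ix] := slopes_cover Ex0 (ltW m0) sm.
    by rewrite mE.
  by exists x => //; rewrite in_fset_set // inE; split=> //; exists s.
have mS : m <= S `^ (d%:R^-1).
  rewrite -[leLHS](powR_root (ltW m0) d0).
  have md0 : 0 <= m ^+ d by rewrite exprn_ge0 ?ltW.
  have mS : m ^+ d <= S.
    apply: le_trans vol; have m2 : m <= 2 * m by rewrite ler_peMl ?ler1n // ltW.
    apply: lerXn2r m2; rewrite nnegrE; first exact: ltW.
    by rewrite mulr_ge0 // ltW.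
  by apply: ge0_ler_powR; rewrite ?nnegrE ?invr_ge0 //; exact: le_trans mS.
have : d%:R * diam a E * m <= d%:R * diam a E * S `^ (d%:R^-1).
  by rewrite ler_wpM2l.
have -> : d%:R * diam a E * m = u x0 - B by rewrite -mE; ring.
lra.
Qed.

End MaximumPrinciple.

(** * The exit kernel of the random walk *)

(** The sites that a walk killed outside [L] can visit, with all their neighbours. *)
Lemma jump_closure (d : nat) (L : set (site d)) (x : site d) : finite_set L ->
  exists r : seq (site d), uniq r /\ forall y, y = x \/ L y ->
    y \in r /\ forall i, y + e_ i \in r /\ y - e_ i \in r.
Proof.
move=> finL.
have [s xLs] : exists s : seq (site d), forall y, y = x \/ L y -> y \in s.
  exists (x :: finmap.enum_fset (fset_set L)) => y; rewrite inE.
  have -> : (y \in finmap.enum_fset (fset_set L)) = (y \in L) by exact: in_fset_set.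
  by case=> [->|Ly]; rewrite ?eqxx // mem_set ?orbT.
exists (undup (s ++ [seq y + e_ i | y <- s, i <- enum 'I_d]
                 ++ [seq y - e_ i | y <- s, i <- enum 'I_d])).
split=> [|y /xLs ys]; first exact: undup_uniq.
rewrite !mem_undup !mem_cat ys; split=> // i; rewrite !mem_undup !mem_cat.
have yi : y + e_ i \in [seq y + e_ i | y <- s, i <- enum 'I_d].
  by apply/allpairsP; exists (y, i); rewrite mem_enum.
have yi' : y - e_ i \in [seq y - e_ i | y <- s, i <- enum 'I_d].
  by apply/allpairsP; exists (y, i); rewrite mem_enum.
by rewrite yi yi' !orbT.
Qed.

Lemma exit_prob_centred (R : realType) (d : nat) (om : site d -> site d -> R)
    (disp : measure_display) (Omega : measurableType disp)
    (P : site d -> probability Omega R) (X : nat -> Omega -> site d)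
    (L : site d -> set (site d)) (x : site d) :
  environment om -> balanced om -> (forall y, om y 0 = 0) ->
  markov_chain om (P x) X x -> finite_set (L x) ->
  exists r : seq (site d), [/\ uniq r,
    forall z, z \notin r -> exit_prob P X L x z = 0
    & forall s, \sum_(z <- r) exit_prob P X L x z * (dot s z - dot s x) = 0].
Proof.
move=> env bal lazy chain finL; have [r [ur rL]] := jump_closure x finL.
exists r; split=> // [z zr|s].
  have := exit_far chain env lazy ur rL zr; rewrite /exit_at /exit_prob.
  by move=> ->.
have harm y : mean om (fun z => dot s z - dot s x) y = dot s y - dot s x.
  exact: mean_dot.
by have := exit_mean chain env lazy ur rL bal harm; rewrite subrr.
Qed.

Theorem theorem15 (R : realType) (d : nat) (om : site d -> site d -> R)
    (eps0 : R) (Y : site d -> site d -> site d)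
    (disp : measure_display) (Omega : measurableType disp)
    (P : site d -> probability Omega R) (X : nat -> Omega -> site d)
    (E : set (site d)) (u g : site d -> R) :
  (2 <= d)%N ->
  environment om -> balanced om -> elliptic om -> (forall x, om x 0 = 0) ->
  0 < eps0 -> (forall x, (ell om eps0 x < +oo)%E) ->
  selection om eps0 Y ->
  (forall x, markov_chain om (P x) X x) ->
  bounded_sites E ->
  let a := exit_prob P X (Lambda om eps0 Y) in
  (forall x, E x -> Iu a u E x !=set0 -> Lop a u x >= - g x) ->
  sup [set u x | x in E] <=
    d%:R * diam a E / eps0
      * (\sum_(x \in [set x | E x /\ Iu a u E x !=set0])
           `|g x * (2 * d)%:R `^ fine (ell om eps0 x)| ^+ d) `^ (d%:R^-1)
    + sup [set u y | y in Eb a E].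
Proof.
move=> d2 env bal _ lazy eps_gt0 fin_ell selY chain bE a super.
have d0 : (0 < d)%N by apply: leq_trans d2.
have finE := bounded_finite bE.
have a0 x z : 0 <= a x z by exact: fine_ge0.
pose W x := (2 * d)%:R `^ fine (ell om eps0 x) / eps0.
have W0 x : 0 < W x by rewrite divr_gt0 // powR_gt0 // ltr0n muln_gt0.
have centred x := exit_prob_centred env bal lazy (chain x)
  (Lambda_finite fin_ell Y x).
have reach x k j : square k -> exists v, [/\ orthant k x v,
    1 <= k 0 j * (v - x) 0 j & 1 <= a x v * W x].
  move=> sk; have [|v [xv fv av]] := @exit_orthant R d om eps0 env bal lazy d0 eps_gt0
      fin_ell Y selY x (a x) _ k j sk.
    by move=> p v steps pL nv; apply: (exit_path (chain x) env).
  by exists v; split=> //; rewrite /W mulrA ler_pdivlMr // mul1r.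
have := maximum_principle d0 a0 W0 centred reach finE super.
set T := [set x | _].
have finT : finite_set T by apply: sub_finite_set finE => x [].
have -> : \sum_(x \in T) `|g x * W x| ^+ d = eps0^-1 ^+ d *
    \sum_(x \in T) `|g x * (2 * d)%:R `^ fine (ell om eps0 x)| ^+ d.
  rewrite mulr_fsumr; apply: eq_fsbigr => x _.
  by rewrite /W mulrA normrM exprMn mulrC [`|eps0^-1|]gtr0_norm ?invr_gt0.
rewrite powRM; [|by rewrite exprn_ge0 ?invr_ge0 ?ltW|]; last first.
  by rewrite fsbig_finite //; apply: sumr_ge0 => x _; rewrite exprn_ge0.
by rewrite powR_root ?invr_ge0 ?(ltW eps_gt0) // !mulrA.
Qed.
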